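(* Let $N\ge 2$ and $1\le k<N$, let $\Omega\subset\mathbb{R}^N$ be a bounded domain, let $H:\Omega\times\mathbb{R}^N\to\mathbb{R}$ be continuous with $|H(x,\xi)|\le b|\xi|$ for all $(x,\xi)\in\Omega\times\mathbb{R}^N$, where $b\ge 0$ is a constant, and let $m>0$ be a constant. (1) Let $u$ satisfy $$\mathcal{P}^-_1(D^2u)+H(x,\nabla u)\ge -m\ \text{ in }\Omega,\qquad u\le 0\ \text{ on }\partial\Omega .$$ Then for any $\gamma\in(0,1)$ there exists a constant $C=C(\gamma,b,m,\|u^+\|_\infty)$ such that $u(x)\le C\,d(x)^\gamma$ for all $x\in\Omega$. (2) Let $R>0$, $\Omega\in\mathcal{C}_R$ and let $u$ satisfy $$\mathcal{P}^+_k(D^2u)+H(x,\nabla u)\ge -m\ \text{ in }\Omega,\qquad u\le 0\ \text{ on }\partial\Omega .$$ If $bR<k$, then there exists a constant $C=C(\Omega,b,k,m)$ such that $u(x)\le C\,d(x)$ for all $x\in\Omega$.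
   Context: For a real symmetric $N\times N$ matrix $X$ with ordered eigenvalues $\lambda_1(X)\le\cdots\le\lambda_N(X)$, $\mathcal{P}^-_k(X)=\sum_{i=1}^k\lambda_i(X)$ and $\mathcal{P}^+_k(X)=\sum_{i=N-k+1}^N\lambda_i(X)$. $d(x)=\inf_{y\in\partial\Omega}|y-x|$. $u^+=\max(u,0)$. $B_R(y)$ is the open ball of radius $R$ centred at $y$; $\mathcal{C}_R$ is the class of bounded domains $\Omega\subset\mathbb{R}^N$ such that $\Omega=\bigcap_{y\in Y}B_R(y)$ for some $Y\subset\mathbb{R}^N$. Inequalities are in the viscosity sense: a real-valued $u$ satisfies $F(x,u,\nabla u,D^2u)\ge 0$ in $\Omega$ (subsolution) if it is upper semicontinuous and, for every $x\in\Omega$ and every $C^2$ function $\varphi$ touching $u$ from above at $x$ (i.e. $\varphi(x)=u(x)$, $\varphi\ge u$ near $x$), $F(x,u(x),\nabla\varphi(x),D^2\varphi(x))\ge 0$. Subsolutions with a boundary condition are real-valued upper semicontinuous functions on $\overline\Omega$. The notation $C=C(\cdots)$ means that the constant depends only on the listed quantities. *)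

(* Defs.v *)
From mathcomp Require Import all_boot all_order all_algebra.
From mathcomp Require Import all_classical all_reals all_analysis.
Set Implicit Arguments.
Unset Strict Implicit.
Unset Printing Implicit Defensive.
Import Order.TTheory GRing.Theory Num.Theory.
Import numFieldNormedType.Exports.
Local Open Scope classical_set_scope.
Local Open Scope ring_scope.

Section Defs.
Variables (R : realType) (N : nat).
Local Notation V := 'rV[R]_N.

(* The library norm on row vectors is the sup norm, which induces the same
   topology and the same bounded sets but not the same distances and balls. *)
Definition enorm (v : V) : R := Num.sqrt (\sum_i v 0 i ^+ 2).

Definition eball (y : V) (r : R) : set V := [set x | enorm (x - y) < r].

Definition boundary (A : set V) : set V := closure A `\` interior A.

Definition bdist (Omega : set V) (x : V) : R :=
  inf [set enorm (y - x) | y in boundary Omega].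

Definition bounded_domain (Omega : set V) : Prop :=
  [/\ Omega !=set0, open Omega, connected Omega & bounded_set Omega].

Definition ball_intersection_class (r : R) (Omega : set V) : Prop :=
  bounded_domain Omega /\
  exists Y : set V, Omega = \bigcap_(y in Y) eball y r.

(* The nondecreasing sequence of the eigenvalues counted with multiplicity; it
   exists and is unique when X is symmetric (the default [::] is used only for
   matrices whose characteristic polynomial does not split over R). *)
Definition eigenvalues (X : 'M[R]_N) : seq R :=
  xget [::] [set s : seq R | sorted <=%R s /\
                             char_poly X = \prod_(a <- s) ('X - a%:P)].

(* Indices are 0-based: lambda_i of the mathematical notation is the item of
   index i - 1 of the sequence. *)
Definition Pminus (k : nat) (X : 'M[R]_N) : R :=
  \sum_(0 <= i < k) (eigenvalues X)`_i.

Definition Pplus (k : nat) (X : 'M[R]_N) : R :=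
  \sum_(N - k <= i < N) (eigenvalues X)`_i.

Definition partial (i : 'I_N) (f : V -> R) (x : V) : R :=
  'D_(delta_mx 0 i) f x.

Definition grad (f : V -> R) (x : V) : V := \row_i partial i f x.

Definition hessian (f : V -> R) (x : V) : 'M[R]_N :=
  \matrix_(i, j) partial i (partial j f) x.

(* Meant for an open set A. *)
Definition C1_on (A : set V) (f : V -> R) : Prop :=
  forall (i : 'I_N) (x : V), A x ->
    derivable f x (delta_mx 0 i) /\ {for x, continuous (partial i f)}.

Definition C2_on (A : set V) (f : V -> R) : Prop :=
  C1_on A f /\ forall i : 'I_N, C1_on A (partial i f).

Definition usc_on (A : set V) (u : V -> R) : Prop :=
  forall (x : V) (a : R), A x -> u x < a ->
    \forall y \near x, A y -> u y < a.

Definition touches_from_above (phi u : V -> R) (x : V) : Prop :=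
  phi x = u x /\ \forall y \near x, u y <= phi y.

(* F x r p X >= 0 in the viscosity sense; only the values of u on the open set
   Omega matter. *)
Definition viscosity_subsolution (Omega : set V)
    (F : V -> R -> V -> 'M[R]_N -> R) (u : V -> R) : Prop :=
  usc_on Omega u /\
  forall (x : V) (phi : V -> R), Omega x -> C2_on Omega phi ->
    touches_from_above phi u x ->
    0 <= F x (u x) (grad phi x) (hessian phi x).

Definition dirichlet_subsolution (Omega : set V)
    (F : V -> R -> V -> 'M[R]_N -> R) (u : V -> R) : Prop :=
  [/\ usc_on (closure Omega) u,
      viscosity_subsolution Omega F u
    & forall x, boundary Omega x -> u x <= 0].

(* The set is bounded above when u is usc on the compact set closure Omega, so
   this is a genuine supremum there. *)
Definition pos_part_supnorm (Omega : set V) (u : V -> R) : R :=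
  sup [set Num.max (u x) 0 | x in closure Omega].

Definition admissible_hamiltonian (Omega : set V) (b : R) (H : V -> V -> R)
    : Prop :=
  {within Omega `*` setT, continuous (fun p : V * V => H p.1 p.2)} /\
  forall x xi : V, Omega x -> `|H x xi| <= b * enorm xi.

End Defs.

(* Main.v *)
Require Import Defs.
From mathcomp Require Import all_boot all_order all_algebra.
From mathcomp Require Import all_classical all_reals all_analysis.
From mathcomp Require Import ring lra.
Set Implicit Arguments.
Unset Strict Implicit.
Unset Printing Implicit Defensive.
Import Order.TTheory GRing.Theory Num.Theory.
Import numFieldNormedType.Exports.
Local Open Scope classical_set_scope.
Local Open Scope ring_scope.

(** Both estimates come from comparing u with an explicit barrier that is a
    function of the squared Euclidean distance Q to a fixed point y.

    Comparison ([comparison]).  If phi is C^2 in the domain, nonnegative on the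
    boundary and a strict classical supersolution wherever phi < u, then
    u <= phi.  Otherwise the usc function u - phi has a positive maximum over
    the compact closure; it is attained inside, where phi plus a constant
    touches u from above, which contradicts the strict inequality.

    The Hessian of F(Q) is 2 F'(Q) Id + 4 F''(Q) (x - y)^T (x - y)
    ([radial_C2]), a rank-one perturbation of a scalar matrix.  When F'' <= 0
    its smallest eigenvalue is 2 F' + 4 F'' Q and all the others are 2 F'
    ([eigenvalues_scalar_rank1]).

    Part 1 ([holder_barrier]): y is a boundary point and phi = C |x - y|^gamma.
    The smallest eigenvalue is - C gamma (1 - gamma) |x - y|^(gamma - 2), and
    near y it dominates both the first-order term
    b C gamma |x - y|^(gamma - 1) and m.  Far from y, phi exceeds the supremum
    of u^+ once C is large.  Taking the infimum over y gives the power of the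
    distance to the boundary.

    Part 2 ([quadratic_barrier]): y is the centre of a ball of radius r that
    contains the domain, and phi = A (r^2 - |x - y|^2), whose Hessian is
    - 2 A Id.  It is a strict supersolution as soon as 2 A (k - b r) > m, which
    is where b r < k enters.  Moreover phi <= 2 A r (r - |x - y|).  A boundary
    point z lies outside some ball of the family, and for its centre
    r - |x - y| <= |z - y| - |x - y| <= |z - x|.  The subsolution property does
    not refer to the radius, so one admissible radius of the domain, chosen
    once and for all, yields a constant valid for every admissible radius. *)

(** * Eigenvalues of rank-one perturbations of scalar matrices *)

(** The block matrix B with rows (1, w) and (u, p Id) is multiplied on either
    side by a lower triangular matrix chosen to clear one block; comparing the
    two determinants gives the identity multiplied by p, which can be
    cancelled. *)
Lemma det_scalar_sub_rank1 (D : idomainType) (n : nat) (p : D)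
    (u : 'cV[D]_n.+1) (w : 'rV[D]_n.+1) : p != 0 ->
  \det (p%:M - u *m w) = (p - (w *m u) 0 0) * p ^+ n.
Proof.
move=> p0.
pose B := block_mx (1%:M : 'M[D]_1) w u p%:M.
have e1 : block_mx (1%:M : 'M[D]_1) 0 (- u) 1%:M *m B
    = block_mx 1%:M w 0 (p%:M - u *m w).
  rewrite mulmx_block !mul1mx !mul0mx !addr0 mulmx1 addNr mulNmx.
  by congr block_mx; rewrite addrC.
have e2 : B *m block_mx (p%:M : 'M[D]_1) 0 (- u) 1%:M
    = block_mx (p%:M - w *m u) w 0 p%:M.
  rewrite mulmx_block !mul1mx !mulmx0 !mulmx1 !add0r mulmxN.
  by rewrite mul_mx_scalar mul_scalar_mx scalerN subrr.
have := congr1 determinant e1.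
rewrite det_mulmx det_lblock det_ublock !det_scalar !expr1n !mul1r => <-.
have := congr1 determinant e2; rewrite det_mulmx det_lblock det_ublock.
rewrite !det_scalar expr1n mulr1 expr1 exprSr mulrA => /(mulIf p0) ->.
by rewrite det_mx11 !mxE eqxx mulr1n.
Qed.

Section Eigenvalues.
Variables (R : realType) (n : nat).

Lemma char_poly_scalar_rank1 (a c : R) (v : 'rV[R]_n.+1) :
  char_poly (a%:M + c *: (v^T *m v)) =
  ('X - (a + c * \sum_i v 0 i ^+ 2)%:P) * ('X - a%:P) ^+ n.
Proof.
rewrite /char_poly.
have -> : char_poly_mx (a%:M + c *: (v^T *m v)) =
  ('X - a%:P)%:M - map_mx polyC (c *: v^T) *m map_mx polyC v.
  rewrite /char_poly_mx map_mxD map_scalar_mx /= -map_mxM /= -scalemxAl.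
  by rewrite raddfB /= opprD addrA.
rewrite det_scalar_sub_rank1 ?polyXsubC_eq0 // -map_mxM !mxE -addrA -opprD.
congr (('X - _) * _); rewrite polyCD; congr (_ + (_)%:P).
by rewrite mulr_sumr; apply: eq_bigr => i _; rewrite !mxE; ring.
Qed.

(** The roots of a split polynomial are determined up to permutation, so
    exhibiting one sorted factorization pins down the chosen value. *)
Lemma eigenvaluesE (X : 'M[R]_n.+1) (s : seq R) : sorted <=%R s ->
  char_poly X = \prod_(a <- s) ('X - a%:P) -> eigenvalues X = s.
Proof.
move=> ss sX; apply: xget_unique => [//|t [st tX]].
apply: (sorted_eq le_trans le_anti) => //.
by apply: prod_XsubC_eq; rewrite -tX.
Qed.

Lemma eigenvalues_scalar_rank1 (a c : R) (v : 'rV[R]_n.+1) : c <= 0 ->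
  eigenvalues (a%:M + c *: (v^T *m v)) =
  (a + c * \sum_i v 0 i ^+ 2) :: nseq n a.
Proof.
move=> c0; apply: eigenvaluesE; last first.
  by rewrite char_poly_scalar_rank1 big_cons big_nseq -Monoid.iteropE.
have le0 : a + c * \sum_i v 0 i ^+ 2 <= a.
  rewrite gerDl mulr_le0_ge0 ?sumr_ge0 // => i _; exact: sqr_ge0.
rewrite /= (path_min_sorted) ?all_nseq ?le0 ?orbT //.
elim: n => [//|[|k] ih] //=.
by rewrite lexx.
Qed.

Lemma Pminus1_scalar_rank1 (a c : R) (v : 'rV[R]_n.+1) : c <= 0 ->
  Pminus 1 (a%:M + c *: (v^T *m v)) = a + c * \sum_i v 0 i ^+ 2.
Proof. by move=> c0; rewrite /Pminus eigenvalues_scalar_rank1 // big_nat1. Qed.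

(** As k <= n, the k largest of the n + 1 eigenvalues avoid the exceptional
    one, which is the smallest since c <= 0. *)
Lemma Pplus_scalar_rank1 (k : nat) (a c : R) (v : 'rV[R]_n.+1) : c <= 0 ->
  (k <= n)%N -> Pplus k (a%:M + c *: (v^T *m v)) = k%:R * a.
Proof.
move=> c0 kn; rewrite /Pplus eigenvalues_scalar_rank1 // (eq_big_nat _ _ (F2 := fun=> a)).
  by rewrite big_const_nat iter_addr_0 subKn ?mulr_natl // ltnW.
move=> [|i] /andP[h1 h2]; first by rewrite leqn0 subn_eq0 ltnNge kn in h1.
by rewrite /= nth_nseq -ltnS h2.
Qed.

End Eigenvalues.

(** * Semicontinuous functions on compact sets *)

Section Usc.
Variable R : realType.

(** The superlevel sets of f through the points of K form a filter base; by
    semicontinuity any cluster point of that filter is a maximum point. *)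
Lemma usc_compact_max (T : topologicalType) (K : set T) (f : T -> R) :
  compact K -> K !=set0 ->
  (forall x a, K x -> f x < a -> \forall y \near x, K y -> f y < a) ->
  exists2 x, K x & forall y, K y -> f y <= f x.
Proof.
move=> cK [x0 Kx0] usc.
pose B y := [set x | K x /\ f y <= f x].
have FB : ProperFilter (filter_from K B).
  apply: filter_from_proper; last by move=> y Ky; exists y.
  apply: filter_from_filter; first by exists x0.
  move=> y z Ky Kz; have [yz|/ltW zy] := leP (f y) (f z).
    by exists z => // x [Kx zx]; split; split => //; apply: le_trans zx.
  by exists y => // x [Kx yx]; split; split => //; apply: le_trans yx.
have [|x [Kx clx]] := cK _ FB; first by exists x0 => // x [].
exists x => // y Ky; rewrite leNgt; apply/negP => xy.
have [|z [[Kz yz] /(_ Kz)]] := clx (B y) _ _ (usc _ _ Kx xy); first by exists y.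
by rewrite ltNge yz.
Qed.

End Usc.

(** * Euclidean norm and squared distance *)

Section EuclideanNorm.
Variables (R : realType) (N : nat).
Local Notation V := 'rV[R]_N.
Implicit Types x y z v w : V.

Definition sqdist (y x : V) : R := \sum_i (x 0 i - y 0 i) ^+ 2.

Lemma sqdist_ge0 y x : 0 <= sqdist y x.
Proof. by apply: sumr_ge0 => i _; exact: sqr_ge0. Qed.

Lemma enorm_subE y x : enorm (x - y) = Num.sqrt (sqdist y x).
Proof. by congr Num.sqrt; apply: eq_bigr => i _; rewrite !mxE. Qed.

Lemma enorm_ge0 v : 0 <= enorm v.
Proof. exact: sqrtr_ge0. Qed.

Lemma sqr_enorm v : enorm v ^+ 2 = \sum_i v 0 i ^+ 2.
Proof. by rewrite sqr_sqrtr // sumr_ge0 // => i _; exact: sqr_ge0. Qed.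

Lemma enorm0_eq0 v : enorm v = 0 -> v = 0.
Proof.
move=> v0; have := sqr_enorm v; rewrite v0 expr0n /= => /esym /eqP.
rewrite psumr_eq0 => [/allP h|i _]; last exact: sqr_ge0.
apply/rowP => i; rewrite mxE; apply/eqP.
by have := h i (mem_index_enum i); rewrite sqrf_eq0.
Qed.

Lemma enormZ (a : R) v : enorm (a *: v) = `|a| * enorm v.
Proof.
rewrite /enorm -sqrtr_sqr -sqrtrM ?sqr_ge0 // mulr_sumr.
by congr Num.sqrt; apply: eq_bigr => i _; rewrite mxE exprMn.
Qed.

Lemma enormN v : enorm (- v) = enorm v.
Proof. by rewrite -scaleN1r enormZ normrN1 mul1r. Qed.

Lemma cauchy_schwarz v w : \sum_i v 0 i * w 0 i <= enorm v * enorm w.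
Proof.
have [/enorm0_eq0 ->|v0] := eqVneq (enorm v) 0.
  rewrite big1 ?mulr_ge0 ?enorm_ge0 // => i _; by rewrite mxE mul0r.
have [/enorm0_eq0 ->|w0] := eqVneq (enorm w) 0.
  rewrite big1 ?mulr_ge0 ?enorm_ge0 // => i _; by rewrite mxE mulr0.
set a := enorm v; set b := enorm w.
have a0 : 0 < a by rewrite lt_def v0 enorm_ge0.
have b0 : 0 < b by rewrite lt_def w0 enorm_ge0.
(* With a = |v| and b = |w|, the inequality is |b v - a w|^2 >= 0 divided
   by 2 a b. *)
have : 0 <= \sum_i (b * v 0 i - a * w 0 i) ^+ 2.
  by apply: sumr_ge0 => i _; exact: sqr_ge0.
have -> : \sum_i (b * v 0 i - a * w 0 i) ^+ 2 =
   b ^+ 2 * (\sum_i v 0 i ^+ 2) + a ^+ 2 * (\sum_i w 0 i ^+ 2)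
   - (2 * a * b) * \sum_i v 0 i * w 0 i.
  rewrite !mulr_sumr -sumrN -!big_split /=; apply: eq_bigr => i _; ring.
rewrite -!sqr_enorm -/a -/b.
have -> : b ^+ 2 * a ^+ 2 + a ^+ 2 * b ^+ 2 - 2 * a * b * \sum_i v 0 i * w 0 i =
  (2 * a * b) * (a * b - \sum_i v 0 i * w 0 i) by ring.
by rewrite pmulr_rge0 ?subr_ge0 // !mulr_gt0.
Qed.

Lemma enormD v w : enorm (v + w) <= enorm v + enorm w.
Proof.
rewrite -(ler_pXn2r (ltn0Sn 1)) ?nnegrE ?addr_ge0 ?enorm_ge0 //.
rewrite sqrrD !sqr_enorm mulr2n.
have -> : \sum_i (v + w) 0 i ^+ 2 = \sum_i v 0 i ^+ 2 + \sum_i w 0 i ^+ 2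
    + (\sum_i v 0 i * w 0 i + \sum_i v 0 i * w 0 i).
  by rewrite -!big_split /=; apply: eq_bigr => i _; rewrite mxE; ring.
by have := cauchy_schwarz v w; lra.
Qed.

Lemma enorm_triangle y z x : enorm (z - y) <= enorm (x - y) + enorm (z - x).
Proof.
have -> : z - y = (x - y) + (z - x) by rewrite [RHS]addrC addrA subrK.
exact: enormD.
Qed.

Lemma sqdist_eq0 y x : sqdist y x = 0 -> x = y.
Proof.
by move=> q0; apply/subr0_eq/enorm0_eq0; rewrite enorm_subE q0 sqrtr0.
Qed.

Lemma continuous_coord (i : 'I_N) : continuous (fun x : V => x 0 i).
Proof. exact: coord_continuous. Qed.

Lemma continuous_sqdist y : continuous (sqdist y).
Proof.
apply: continuous_big => [|i _ x]; first exact: add_continuous.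
have h : {for x, continuous (fun x0 : V => x0 0 i - y 0 i)}.
  apply: continuousB; [exact: continuous_coord | exact: cst_continuous].
exact: (continuousM h h).
Qed.

Lemma is_derive_coord x v (i : 'I_N) : is_derive x v (fun z : V => z 0 i) (v 0 i).
Proof.
have dfx := @differentiable_coord R 1 N x 0 i.
apply: DeriveDef; first exact/diff_derivable.
have @f : {linear V -> R}.
  by exists (fun z : V => z 0 i); do 2![eexists]; do ?[constructor];
     rewrite ?mxE // => ? *; rewrite ?mxE //; move=> ?; rewrite !mxE.
rewrite deriveE // (_ : (fun _ => _) = f) // diff_lin //.
exact/coord_continuous.
Qed.

(** A directional derivative is the derivative at 0 of the restriction to a
    line, so the one-variable chain rule applies. *)
Lemma is_derive_comp_dir (f : V -> R) (g : R -> R) x v (a b : R) :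
  is_derive x v f b -> is_derive (f x) 1 g a -> is_derive x v (g \o f) (a * b).
Proof.
have lineE (h : V -> R) : 'D_v h x = 'D_1 (fun t : R => h (t *: v + x)) 0.
  rewrite /derive; set g1 := fun t => t^-1 *: _; set g2 := fun t => t^-1 *: _.
  suff -> : g1 = g2 by [].
  apply/funext => t; rewrite /g1 /g2 /=.
  by rewrite addr0 scale0r add0r [_%:A]mulr1.
move=> [df ef] dg.
have d1 : is_derive (0 : R) 1 (fun t : R => f (t *: v + x)) b.
  by split; [exact: (derivable1P f x v).1 | rewrite -lineE].
have d2 : is_derive (0 : R) 1 (g \o (fun t : R => f (t *: v + x))) (a * b).
  by apply: is_derive1_comp; rewrite scale0r add0r.
case: d2 => d2 e2; split; first exact: (derivable1P (g \o f) x v).2.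
by rewrite lineE.
Qed.

Lemma is_derive_coord_sub y x (i j : 'I_N) :
  is_derive x (delta_mx 0 j) (fun z : V => z 0 i - y 0 i) (i == j)%:R.
Proof.
have := is_deriveD (is_derive_coord x (delta_mx 0 j) i)
  (is_derive_cst (- y 0 i) x (delta_mx 0 j)).
by rewrite addr0 mxE eqxx.
Qed.

Lemma is_derive_sqdist y x (j : 'I_N) :
  is_derive x (delta_mx 0 j) (sqdist y) (2 * (x 0 j - y 0 j)).
Proof.
have -> : sqdist y = \sum_i (fun z : V => z 0 i - y 0 i) ^+ 2.
  by apply/funext => z; rewrite fct_sumE.
have := is_derive_sum (fun i => is_deriveX 2 (is_derive_coord_sub y x i j)).
move/is_derive_eq; apply.
rewrite (bigD1 j) //= eqxx big1 => [|i /negPf ij]; last first.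
  by rewrite ij scaler0.
by rewrite addr0 expr1 /GRing.scale /= mulr1.
Qed.

End EuclideanNorm.

(** * Radial C^2 functions *)

Section RadialCalculus.
Variables (R : realType) (N : nat).
Local Notation V := 'rV[R]_N.

Lemma near_eq_continuous (T : topologicalType) (f g : T -> R) (x : T) :
  (\forall z \near x, g z = f z) -> {for x, continuous f} ->
  {for x, continuous g}.
Proof.
move=> fg cf; rewrite /prop_for /continuous_at (nbhs_singleton fg).
apply: cvg_trans cf; apply: near_eq_cvg.
by apply: filterS fg => z ->.
Qed.

(** Formulas for the derivatives that hold on an open set A may be
    differentiated there again, because each point of A has a neighbourhood on
    which they hold.  Powers of the distance to a boundary point satisfy them
    only on such a set, being singular at the point. *)
Lemma C2_on_derivatives (A : set V) (f : V -> R) (g : 'I_N -> V -> R)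
    (h : 'I_N -> 'I_N -> V -> R) : open A ->
  (forall x i, A x -> is_derive x (delta_mx 0 i) f (g i x)) ->
  (forall x i j, A x -> is_derive x (delta_mx 0 j) (g i) (h i j x)) ->
  (forall x i, A x -> {for x, continuous (g i)}) ->
  (forall x i j, A x -> {for x, continuous (h i j)}) ->
  C2_on A f /\ forall x, A x ->
    grad f x = \row_i g i x /\ hessian f x = \matrix_(i, j) h j i x.
Proof.
move=> oA df dg cg ch.
have nearA x : A x -> \forall z \near x, A z by move=> Ax; exact: open_nbhs_nbhs.
have p1 x i : A x -> partial i f x = g i x.
  by move=> /(df _ i) dfx; rewrite /partial derive_val.
have n1 x i : A x -> \forall z \near x, g i z = partial i f z.
  by move=> /nearA; apply: filterS => z /p1 ->.
have d2 x i j : A x -> is_derive x (delta_mx 0 j) (partial i f) (h i j x).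
  by move=> Ax; apply: (near_eq_is_derive (n1 _ _ Ax)); exact: dg.
have p2 x i j : A x -> partial j (partial i f) x = h i j x.
  by move=> /(d2 _ i j) dgx; rewrite /partial derive_val.
split; last first.
  move=> x Ax; split; first by apply/rowP => i; rewrite !mxE p1.
  by apply/matrixP => i j; rewrite !mxE p2.
split=> [i x Ax|i j x Ax].
  split; first exact: (ex_derive (is_derive := df x i Ax)).
  apply: near_eq_continuous (cg x i Ax).
  by apply: filterS (n1 x i Ax) => z ->.
split; first exact: (ex_derive (is_derive := d2 x i j Ax)).
apply: near_eq_continuous (ch x i j Ax).
by apply: filterS (nearA _ Ax) => z /p2 ->.
Qed.

Lemma radial_C2 (A : set V) (y : V) (F F1 F2 : R -> R) : open A ->
  (forall x, A x -> is_derive (sqdist y x) 1 F (F1 (sqdist y x))) ->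
  (forall x, A x -> is_derive (sqdist y x) 1 F1 (F2 (sqdist y x))) ->
  (forall x, A x -> {for sqdist y x, continuous F2}) ->
  C2_on A (F \o sqdist y) /\ forall x, A x ->
    grad (F \o sqdist y) x = (2 * F1 (sqdist y x)) *: (x - y) /\
    hessian (F \o sqdist y) x = (2 * F1 (sqdist y x))%:M
      + (4 * F2 (sqdist y x)) *: ((x - y)^T *m (x - y)).
Proof.
move=> oA dF dF1 cF2.
pose g (i : 'I_N) (x : V) := F1 (sqdist y x) * (2 * (x 0 i - y 0 i)).
pose h (i j : 'I_N) (x : V) :=
  F1 (sqdist y x) * (2 * (i == j)%:R) +
  2 * (x 0 i - y 0 i) * (F2 (sqdist y x) * (2 * (x 0 j - y 0 j))).
have cc (i : 'I_N) x : {for x, continuous (fun z : V => 2 * (z 0 i - y 0 i))}.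
  apply: continuousM; first exact: cst_continuous.
  apply: continuousB; [exact: continuous_coord | exact: cst_continuous].
have cF1 x : A x -> {for x, continuous (F1 \o sqdist y)}.
  move=> Ax; apply: continuous_comp; first exact: continuous_sqdist.
  apply/differentiable_continuous/derivable1_diffP.
  exact: (ex_derive (is_derive := dF1 x Ax)).
have cF2' x : A x -> {for x, continuous (F2 \o sqdist y)}.
  by move=> Ax; apply: continuous_comp; [exact: continuous_sqdist | exact: cF2].
have [||||C2f fE] := @C2_on_derivatives A (F \o sqdist y) g h oA.
- move=> x i Ax; apply: is_derive_comp_dir; [exact: is_derive_sqdist | exact: dF].
- move=> x i j Ax.
  have d1 := is_derive_comp_dir (is_derive_sqdist y x j) (dF1 x Ax).
  have d2 := is_deriveZ 2 (is_derive_coord_sub y x i j).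
  exact: (is_deriveM d1 d2).
- by move=> x i Ax; apply: continuousM; [exact: cF1 | exact: cc].
- move=> x i j Ax; apply: continuousD.
    by apply: continuousM; [exact: cF1 | exact: cst_continuous].
  apply: continuousM; first exact: cc.
  by apply: continuousM; [exact: cF2' | exact: cc].
split=> // x Ax; have [-> ->] := fE x Ax; split.
  by apply/rowP => i; rewrite !mxE /g; ring.
by apply/matrixP => i j; rewrite !mxE big_ord1 !mxE /h eq_sym -mulr_natr; ring.
Qed.

End RadialCalculus.

(** * Comparison with strict supersolutions *)

Section MaximumPrinciple.
Variables (R : realType) (n : nat).
Local Notation N := n.+1.
Local Notation V := 'rV[R]_N.
Implicit Types (Omega : set V) (u phi : V -> R).

Lemma bounded_domain_compact_closure Omega :
  bounded_domain Omega -> compact (closure Omega).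
Proof.
move=> [_ _ _ [M [Mr bM]]]; apply: bounded_closed_compact; last exact: closed_closure.
exists M; split=> // a Ma.
have cl : closed [set x : V | `|x| <= a].
  rewrite (_ : [set x : V | _] = (fun x : V => `|x|) @^-1` [set t | t <= a]) //.
  by apply: closed_comp => [x _|]; [exact: norm_continuous | exact: closed_le].
by move=> x clx; exact: (cl x (closure_subset (bM a Ma) clx)).
Qed.

Lemma closure_open_boundary Omega x : open Omega ->
  closure Omega x -> Omega x \/ boundary Omega x.
Proof.
move=> /interior_id oO clx; have [|nOx] := pselect (Omega x); first by left.
by right; split=> //; rewrite oO.
Qed.

Lemma boundary_not_in Omega x : open Omega -> boundary Omega x -> ~ Omega x.
Proof. by move=> /interior_id oO []; rewrite oO. Qed.

(** The infimum of the empty set would be 0 by convention, so the distance to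
    the boundary needs this.  A point of the closure that maximizes the first
    coordinate cannot lie in the open set. *)
Lemma boundary_nonempty Omega : bounded_domain Omega -> boundary Omega !=set0.
Proof.
move=> bO; have [[x0 Ox0] oO _ _] := bO.
have [||x clx xmax] := usc_compact_max (f := fun x : V => x 0 0)
    (bounded_domain_compact_closure bO).
- by exists x0; exact: subset_closure.
- move=> x a _ xa; have : \forall z \near x, (z : V) 0 0 < a.
    exact: (@cvgr_lt _ _ (nbhs x) _ (fun z : V => z 0 0) _
      (@continuous_coord R N 0 x) _ xa).
  by apply: filterS => z za _.
have [Ox|] := closure_open_boundary oO clx; last by exists x.
have : \forall t \near (0 : R), Omega (t *: delta_mx 0 0 + x).
  have ct : {for (0 : R), continuous (fun t : R => t *: (delta_mx 0 0 : V) + x)}.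
    apply: continuousD; last exact: cst_continuous.
    exact: scalel_continuous.
  by apply: ct; rewrite scale0r add0r; exact: open_nbhs_nbhs.
move=> /nbhs_ballP [e /= e0 he].
have /xmax : closure Omega ((e / 2) *: delta_mx 0 0 + x).
  apply/subset_closure/he; rewrite -ball_normE /= sub0r normrN gtr0_norm ?divr_gt0 //.
  by lra.
by rewrite !mxE !eqxx mulr1 gerDr leNgt divr_gt0.
Qed.

Lemma le_pos_part_supnorm Omega u x : bounded_domain Omega ->
  usc_on (closure Omega) u -> Omega x -> u x <= pos_part_supnorm Omega u.
Proof.
move=> bO uscu Ox.
have cx : closure Omega x by exact: subset_closure.
have [|z _ zmax] := usc_compact_max (bounded_domain_compact_closure bO) _ uscu.
  by exists x.
apply: (@le_trans _ _ (Num.max (u x) 0)); first by rewrite le_max lexx.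
apply: sup_upper_bound; last by exists x.
split; first by exists (Num.max (u x) 0); exists x.
exists (Num.max (u z) 0) => _ [w cw <-].
by rewrite ge_max !le_max lexx orbT zmax.
Qed.

Lemma usc_onD (A : set V) f g : usc_on A f -> usc_on A g ->
  usc_on A (fun x => f x + g x).
Proof.
move=> uf ug x a Ax fga; pose e := (a - (f x + g x)) / 2.
have e0 : 0 < e by rewrite divr_gt0 // subr_gt0.
have uf' : \forall y \near x, A y -> f y < f x + e by apply: uf; rewrite // ltrDl.
have ug' : \forall y \near x, A y -> g y < g x + e by apply: ug; rewrite // ltrDl.
apply: filterS2 uf' ug' => z fz gz Az.
by have := fz Az; have := gz Az; rewrite /e; lra.
Qed.

Lemma partial_addcst (i : 'I_N) phi (c : R) :
  partial i (fun x => phi x + c) = partial i phi.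
Proof.
apply/funext => x; rewrite /partial /derive.
set g1 := fun t => t^-1 *: _; set g2 := fun t => t^-1 *: _.
suff -> : g1 = g2 by [].
by apply/funext => t; rewrite /g1 /g2 /= opprD addrACA subrr addr0.
Qed.

Lemma C2_on_addcst (A : set V) phi (c : R) : C2_on A phi ->
  C2_on A (fun x => phi x + c).
Proof.
move=> [C1 C2]; split=> i; rewrite ?partial_addcst //.
move=> x Ax; have [d1 d2] := C1 i x Ax; split=> //.
exact: (derivableD d1 (derivable_cst c x (delta_mx 0 i))).
Qed.

(** The strict inequality is required only where phi < u: this confines the
    analysis to the region where the barrier is below the bound on u, without
    cutting the domain. *)
Lemma comparison Omega (G : V -> V -> 'M[R]_N -> R) u phi :
  bounded_domain Omega ->
  dirichlet_subsolution Omega (fun x _ xi X => G x xi X) u ->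
  C2_on Omega phi ->
  usc_on (closure Omega) (fun x => - phi x) ->
  (forall x, boundary Omega x -> 0 <= phi x) ->
  (forall x, Omega x -> phi x < u x -> G x (grad phi x) (hessian phi x) < 0) ->
  forall x, Omega x -> u x <= phi x.
Proof.
move=> bO [uscu [_ visc] ub] C2 lsc phib strict x Ox.
have [_ oO _ _] := bO.
have cx : closure Omega x by exact: subset_closure.
have [|z clz zmax] := usc_compact_max (bounded_domain_compact_closure bO) _
    (usc_onD uscu lsc); first by exists x.
rewrite leNgt; apply/negP => xlt.
have zlt : phi z < u z by have := zmax x cx; lra.
have Oz : Omega z.
  have [//|bz] := closure_open_boundary oO clz.
  by have := ub z bz; have := phib z bz; lra.
(* z maximizes u - phi, so phi + c touches u from above at z. *)
pose c := u z - phi z.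
have := visc z (fun w => phi w + c) Oz (C2_on_addcst c C2).
have -> : grad (fun w => phi w + c) z = grad phi z.
  by apply/rowP => i; rewrite !mxE partial_addcst.
have -> : hessian (fun w => phi w + c) z = hessian phi z.
  by apply/matrixP => i j; rewrite !mxE partial_addcst.
rewrite leNgt strict //= => /(_ _) h; suff : false by []; apply: h.
split; first by rewrite /c addrC subrK.
have : \forall w \near z, Omega w by exact: open_nbhs_nbhs.
apply: filterS => w Ow; have := zmax w (subset_closure Ow).
by rewrite /c; lra.
Qed.

End MaximumPrinciple.

(** * Barriers and boundary estimates *)

Section BoundaryEstimates.
Variables (R : realType) (n : nat).
Local Notation N := n.+1.
Local Notation V := 'rV[R]_N.
Implicit Types (Omega : set V) (H : V -> V -> R) (u : V -> R).

Lemma sum_sqr_subE (y x : V) : \sum_i (x - y) 0 i ^+ 2 = sqdist y x.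
Proof. by apply: eq_bigr => i _; rewrite !mxE. Qed.

Lemma sqr_enorm_sub (y x : V) : enorm (x - y) ^+ 2 = sqdist y x.
Proof. by rewrite sqr_enorm sum_sqr_subE. Qed.

Lemma enorm_subC (y x : V) : enorm (y - x) = enorm (x - y).
Proof. by rewrite -enormN opprB. Qed.

Lemma powR_sqdist (y x : V) (gamma : R) :
  sqdist y x `^ (gamma / 2) = enorm (y - x) `^ gamma.
Proof.
rewrite enorm_subC -sqr_enorm_sub -powR_mulrn ?enorm_ge0 // -powRrM.
by congr (_ `^ _); field.
Qed.

Lemma le_bdist Omega x (a : R) : boundary Omega !=set0 ->
  (forall y, boundary Omega y -> a <= enorm (y - x)) -> a <= bdist Omega x.
Proof.
move=> [y By] h; apply: lb_le_inf => [|_ [z Bz <-]]; last exact: h.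
by exists (enorm (y - x)); exists y.
Qed.

Lemma bdist_ge0 Omega x : boundary Omega !=set0 -> 0 <= bdist Omega x.
Proof. by move=> B0; apply: le_bdist => // y _; exact: enorm_ge0. Qed.

(** Since t |-> t^gamma is increasing, each bound is a lower bound
    (a / C)^(1 / gamma) on |y - x|, and these pass to the infimum over y. *)
Lemma le_powR_bdist Omega x (gamma C a : R) : 0 < gamma -> 0 < C ->
  boundary Omega !=set0 ->
  (forall y, boundary Omega y -> a <= C * enorm (y - x) `^ gamma) ->
  a <= C * bdist Omega x `^ gamma.
Proof.
move=> g0 C0 B0 h; have [a0|a0] := leP a 0.
  by apply: (le_trans a0); rewrite mulr_ge0 ?powR_ge0 // ltW.
have powK (t : R) : 0 <= t -> (t `^ gamma^-1) `^ gamma = t.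
  by move=> t0; rewrite -powRrM mulVf ?gt_eqF // powRr1.
have powK' (t : R) : 0 <= t -> (t `^ gamma) `^ gamma^-1 = t.
  by move=> t0; rewrite -powRrM mulfV ?gt_eqF // powRr1.
have aC : 0 <= a / C by rewrite divr_ge0 // ltW.
rewrite mulrC -ler_pdivrMr // -[leLHS]powK //.
apply: ge0_ler_powR; rewrite ?nnegrE ?powR_ge0 ?bdist_ge0 // ?(ltW g0) //.
apply: le_bdist => // y By; rewrite -[leRHS]powK' ?enorm_ge0 //.
apply: ge0_ler_powR; rewrite ?nnegrE ?powR_ge0 ?invr_ge0 ?(ltW g0) //.
by rewrite ler_pdivrMr // mulrC h.
Qed.

(** The hypothesis on C r0^gamma forces |x - y| < r0 wherever the barrier is
    below u.  There |x - y|^(gamma - 2) >= 1 since r0 <= 1, and the first-order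
    term is at most half of the second-order one since
    b r0 <= (1 - gamma) / 2; the bound on 2 m then makes the barrier strict. *)
Lemma holder_barrier (gamma b m M C r0 : R) Omega H u :
  0 < gamma -> gamma < 1 -> 0 <= b -> 0 < r0 -> r0 <= 1 ->
  b * r0 <= (1 - gamma) / 2 ->
  2 * m < C * (gamma * (1 - gamma)) -> M <= C * r0 `^ gamma -> 0 < C ->
  bounded_domain Omega -> admissible_hamiltonian Omega b H ->
  dirichlet_subsolution Omega
    (fun x _ xi X => Pminus 1 X + H x xi + m) u ->
  (forall x, Omega x -> u x <= M) ->
  forall x y, Omega x -> boundary Omega y -> u x <= C * enorm (y - x) `^ gamma.
Proof.
move=> g0 g1 b0 r00 r01 br0 mC MC C0 bO [_ Hb] subu uM x y Ox By.
have [_ oO _ _] := bO.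
pose p := gamma / 2.
pose F (t : R) := C * t `^ p.
pose F1 (t : R) := C * (p * t `^ (p - 1)).
pose F2 (t : R) := C * (p * ((p - 1) * t `^ (p - 1 - 1))).
have Q0 z : Omega z -> 0 < sqdist y z.
  move=> Oz; rewrite lt_def sqdist_ge0 andbT; apply/eqP => /sqdist_eq0 zy.
  by apply: (boundary_not_in oO By); rewrite -zy.
have dF (t : R) : 0 < t -> is_derive t 1 F (F1 t).
  by move=> t0; exact: (is_deriveZ C (is_derive1_powR p t0)).
have dF1 (t : R) : 0 < t -> is_derive t 1 F1 (F2 t).
  move=> t0.
  exact: (is_deriveZ C (is_deriveZ p (is_derive1_powR (p - 1) t0))).
have cpow (q t : R) : 0 < t -> {for t, continuous (fun s : R => s `^ q)}.
  move=> t0; apply/differentiable_continuous/derivable1_diffP.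
  exact: (ex_derive (is_derive := is_derive1_powR q t0)).
have cF2 (t : R) : 0 < t -> {for t, continuous F2}.
  move=> t0.
  by do 3![apply: continuousM; first exact: cst_continuous]; exact: cpow.
have [C2 phiE] := radial_C2 oO (fun z Oz => dF _ (Q0 z Oz))
  (fun z Oz => dF1 _ (Q0 z Oz)) (fun z Oz => cF2 _ (Q0 z Oz)).
have F0 z : 0 <= (F \o sqdist y) z by rewrite mulr_ge0 ?powR_ge0 // ltW.
rewrite -powR_sqdist.
have := @comparison R n Omega (fun x xi X => Pminus 1 X + H x xi + m) u
  (F \o sqdist y) bO subu C2.
apply => //.
- (* At z = y the barrier attains its minimum 0, hence lower semicontinuity. *)
  move=> z a _ za; have [zy|zy] := eqVneq (sqdist y z) 0.
    rewrite /F /= zy powR0 ?mulr0 ?oppr0 ?gt_eqF ?divr_gt0 // in za.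
    by apply: (@filterE _ (nbhs z)) => w _; apply: le_lt_trans za; rewrite oppr_le0.
  have cz : {for z, continuous (fun w => - (F \o sqdist y) w)}.
    apply: (@continuousN _ _ _ (F \o sqdist y)).
    apply: continuous_comp; first exact: continuous_sqdist.
    apply: continuousM; first exact: cst_continuous.
    by apply: cpow; rewrite lt_def zy sqdist_ge0.
  apply: (@filterS _ (nbhs z)) (@cvgr_lt _ _ (nbhs z) _ _ _ cz _ za) => w wa _; exact: wa.
- move=> z Oz phiu; have [-> ->] := phiE z Oz.
  set Q := sqdist y z in phiu *.
  have Qgt0 : 0 < Q by exact: Q0.
  have Qr0 : Num.sqrt Q < r0.
    rewrite -(ltr_pXn2r (ltn0Sn 1)) ?nnegrE ?sqrtr_ge0 ?(ltW r00) //.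
    rewrite sqr_sqrtr ?(ltW Qgt0) // ltNge; apply/negP => r0Q.
    have : r0 `^ gamma <= Q `^ p.
      have -> : r0 `^ gamma = (r0 ^+ 2) `^ p.
        by rewrite -powR_mulrn ?(ltW r00) // -powRrM; congr (_ `^ _); rewrite /p; field.
      by apply: ge0_ler_powR; rewrite ?nnegrE ?divr_ge0 ?sqr_ge0 ?(ltW Qgt0) ?(ltW g0).
    rewrite -(ler_pM2l C0) => hQ.
    by have := uM z Oz; move: phiu; rewrite /F /= -/Q; lra.
  have s1 : 1 <= Q `^ (p - 1).
    rewrite -[leLHS](powRr0 Q); apply: ger_powR; last by rewrite /p; lra.
    rewrite Qgt0 /= -(sqr_sqrtr (ltW Qgt0)) expr_le1 ?sqrtr_ge0 //; lra.
  set s := Q `^ (p - 1) in s1.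
  have QF2 : F2 Q * Q = C * (p * ((p - 1) * s)).
    have -> : s = Q `^ (p - 1 - 1) * Q.
      rewrite -[X in _ * X](powRr1 (ltW Qgt0)) -powRD; first by rewrite subrK.
      by rewrite (gt_eqF Qgt0) implybT.
    by rewrite /F2; ring.
  have p1 : p - 1 < 0 by rewrite /p; lra.
  have F1pos : 0 <= 2 * F1 Q.
    by rewrite /F1 -/s !mulr_ge0 ?(ltW C0) ?divr_ge0 ?(ltW g0) //; lra.
  rewrite Pminus1_scalar_rank1; last first.
    rewrite /F2 mulr_ge0_le0 // mulr_ge0_le0 ?(ltW C0) //.
    rewrite mulr_ge0_le0 ?divr_ge0 ?(ltW g0) //.
    by rewrite mulr_le0_ge0 ?powR_ge0 // ltW.
  rewrite sum_sqr_subE -/Q -mulrA QF2.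
  have := ler_norm (H z ((2 * F1 Q) *: (z - y))).
  have := Hb z ((2 * F1 Q) *: (z - y)) Oz.
  rewrite enormZ (ger0_norm F1pos) enorm_subE -/Q => h1 h2.
  have h3 : b * Num.sqrt Q <= (1 - gamma) / 2.
    by apply: le_trans br0; rewrite ler_wpM2l // ltW.
  have h4 : (2 * F1 Q) * (b * Num.sqrt Q) <= (2 * F1 Q) * ((1 - gamma) / 2).
    by rewrite ler_wpM2l.
  have F1E : 2 * F1 Q = C * gamma * s by rewrite /F1 -/s /p; field.
  have h5 : C * (gamma * (1 - gamma)) <= C * (gamma * (1 - gamma)) * s.
    rewrite ler_peMr // !mulr_ge0 ?(ltW C0) ?(ltW g0) //; lra.
  have -> : 2 * F1 Q + 4 * (C * (p * ((p - 1) * s))) =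
      - (C * (gamma * (1 - gamma)) * s).
    by rewrite F1E /p; field.
  have h6 : C * gamma * s * ((1 - gamma) / 2) =
      C * (gamma * (1 - gamma)) * s / 2 by field.
  move: h1 h4; rewrite F1E h6 => h1 h4.
  have h7 : b * (C * gamma * s * Num.sqrt Q) = C * gamma * s * (b * Num.sqrt Q).
    by ring.
  rewrite h7 in h1; rewrite F1E in h2; lra.
Qed.

(** The Hessian is - 2 A Id and the gradient has norm 2 A |x - y| <= 2 A r, so
    the operator is at most - 2 A (k - b r) + m < 0. *)
Lemma quadratic_barrier (k : nat) (b m r A : R) Omega H u (y : V) :
  (k <= n)%N -> 0 <= b -> 0 < A -> 0 < r -> m < 2 * A * (k%:R - b * r) ->
  Omega `<=` eball y r ->
  bounded_domain Omega -> admissible_hamiltonian Omega b H ->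
  dirichlet_subsolution Omega
    (fun x _ xi X => Pplus k X + H x xi + m) u ->
  forall x, Omega x -> u x <= A * (r ^+ 2 - enorm (x - y) ^+ 2).
Proof.
move=> kn b0 A0 r0 mA Oball bO [_ Hb] subu x Ox.
have [_ oO _ _] := bO.
have Qr z : closure Omega z -> sqdist y z <= r ^+ 2.
  have cl : closed [set z : V | sqdist y z <= r ^+ 2].
    rewrite (_ : [set z | _] = sqdist y @^-1` [set t | t <= r ^+ 2]) //.
    by apply: closed_comp => [w _|]; [exact: continuous_sqdist | exact: closed_le].
  move=> clz; apply: (cl z); apply: closure_subset clz => w /Oball /= wr.
  by rewrite -sqr_enorm_sub ler_pXn2r ?nnegrE ?enorm_ge0 ?(ltW r0) // ltW.
pose F (t : R) := A * (r ^+ 2 - t).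
have dF (t : R) : is_derive t 1 F (- A).
  have h := is_deriveB (is_derive_cst (r ^+ 2) t 1) (is_derive_id t (1 : R)).
  have := is_deriveZ A h; move/is_derive_eq; apply.
  by rewrite sub0r /GRing.scale /= mulrN1.
have [C2 phiE] := @radial_C2 R N Omega y F (fun=> - A) (fun=> 0) oO
  (fun z _ => dF _) (fun z _ => is_derive_cst _ _ _)
  (fun z _ => @cst_continuous R R 0 _).
rewrite sqr_enorm_sub.
have := @comparison R n Omega (fun x xi X => Pplus k X + H x xi + m) u
  (F \o sqdist y) bO subu C2.
apply => //.
- move=> z a _ za.
  have cz : {for z, continuous (fun w => - (F \o sqdist y) w)}.
    apply: (@continuousN _ _ _ (F \o sqdist y)).
    apply: continuous_comp; first exact: continuous_sqdist.
    apply: continuousM; first exact: cst_continuous.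
    by apply: continuousB; [exact: cst_continuous | exact: cvg_id].
  apply: (@filterS _ (nbhs z)) (@cvgr_lt _ _ (nbhs z) _ _ _ cz _ za) => w wa _; exact: wa.
- move=> z [clz _]; rewrite mulr_ge0 ?(ltW A0) // subr_ge0; exact: Qr.
- move=> z Oz _; have [-> ->] := phiE z Oz.
  rewrite Pplus_scalar_rank1 ?mulr0 //.
  have := ler_norm (H z ((2 * - A) *: (z - y))).
  have := Hb z ((2 * - A) *: (z - y)) Oz.
  rewrite enormZ normrM normrN (gtr0_norm A0) (gtr0_norm (ltr0n _ 2)) => h1 h2.
  have zr : enorm (z - y) <= r by exact/ltW/Oball.
  have : b * (2 * A * enorm (z - y)) <= b * (2 * A * r).
    by rewrite ler_wpM2l // ler_wpM2l // mulr_ge0 // ltW.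
  by move: mA; rewrite mulrBr; lra.
Qed.

End BoundaryEstimates.

Theorem proposition2p8 (R : realType) :
  (forall gamma b m M : R, 0 < gamma -> gamma < 1 -> 0 <= b -> 0 < m ->
    exists C : R,
      forall (N : nat) (Omega : set 'rV[R]_N) (H : 'rV[R]_N -> 'rV[R]_N -> R)
             (u : 'rV[R]_N -> R),
        (2 <= N)%N ->
        bounded_domain Omega ->
        admissible_hamiltonian Omega b H ->
        dirichlet_subsolution Omega
          (fun x _ xi X => Pminus 1 X + H x xi + m) u ->
        pos_part_supnorm Omega u = M ->
        forall x, Omega x -> u x <= C * (bdist Omega x `^ gamma))
  /\
  (forall (N k : nat) (Omega : set 'rV[R]_N) (b m : R),
    (2 <= N)%N -> (1 <= k)%N -> (k < N)%N ->
    bounded_domain Omega -> 0 <= b -> 0 < m ->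
    exists C : R,
      forall (r : R) (H : 'rV[R]_N -> 'rV[R]_N -> R) (u : 'rV[R]_N -> R),
        0 < r ->
        ball_intersection_class r Omega ->
        b * r < k%:R ->
        admissible_hamiltonian Omega b H ->
        dirichlet_subsolution Omega
          (fun x _ xi X => Pplus k X + H x xi + m) u ->
        forall x, Omega x -> u x <= C * bdist Omega x).
Proof.
split.
  move=> gamma b m M g0 g1 b0 m0.
  (* r0 is such that b r0 <= (1 - gamma) / 2 and r0 <= 1; C1 beats m near y and
     C2 beats M at distance r0. *)
  pose r0 : R := (1 - gamma) / (2 * (b + 1)).
  have b1 : 0 < 2 * (b + 1) by lra.
  have r00 : 0 < r0 by rewrite divr_gt0 ?subr_gt0.
  have r01 : r0 <= 1 by rewrite ler_pdivrMr //; lra.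
  have br0 : b * r0 <= (1 - gamma) / 2.
    rewrite mulrA ler_pdivrMr //.
    have -> : (1 - gamma) / 2 * (2 * (b + 1)) = (1 - gamma) * b + (1 - gamma) by field.
    by lra.
  have gg : 0 < gamma * (1 - gamma) by rewrite mulr_gt0 // subr_gt0.
  have rg : 0 < r0 `^ gamma by exact: powR_gt0.
  pose C1 := 2 * (m + 1) / (gamma * (1 - gamma)).
  pose C2 := `|M| / r0 `^ gamma.
  have C10 : 0 < C1 by rewrite divr_gt0 //; lra.
  have C20 : 0 <= C2 by rewrite divr_ge0 // ltW.
  have C0 : 0 < C1 + C2 by lra.
  have mC : 2 * m < (C1 + C2) * (gamma * (1 - gamma)).
    rewrite [ltRHS]mulrDl /C1 divfK ?gt_eqF //.
    have : 0 <= C2 * (gamma * (1 - gamma)) by rewrite mulr_ge0 // ltW.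
    by lra.
  have MC : M <= (C1 + C2) * r0 `^ gamma.
    rewrite mulrDl /C2 divfK ?gt_eqF //.
    have : 0 <= C1 * r0 `^ gamma by rewrite mulr_ge0 // ltW.
    by have := ler_norm M; lra.
  exists (C1 + C2) => -[//|n] Omega H u _ bO HH subu uM x Ox.
  have uleM z : Omega z -> u z <= M.
    move=> Oz; rewrite -uM; apply: le_pos_part_supnorm => //.
    by case: subu.
  apply: le_powR_bdist => //; first exact: boundary_nonempty.
  move=> y By.
  exact: (@holder_barrier R n gamma b m M (C1 + C2) r0 Omega H u).
move=> [//|n] k Omega b m _ k1 kn bO b0 m0.
(* Any radius will do: the constant is built from a single admissible one, and
   if there is none the claim is vacuous. *)
have [[r [r0 br [_ [Y OY]]]]|no] := pselect (exists r : R,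
    [/\ 0 < r, b * r < k%:R & ball_intersection_class r Omega]); last first.
  by exists 0 => r H u r0 cl br; case: no; exists r.
have kbr : 0 < k%:R - b * r by rewrite subr_gt0.
pose A := m / (k%:R - b * r).
have A0 : 0 < A by exact: divr_gt0.
have Ar : 0 < 2 * A * r by rewrite mulr_gt0 // mulr_gt0.
exists (2 * A * r) => _ H u _ _ _ HH subu x Ox.
rewrite -ler_pdivrMl //; apply: le_bdist; first exact: boundary_nonempty.
move=> z Bz; rewrite ler_pdivrMl //.
have [_ oO _ _] := bO.
(* The ball of the family that misses the boundary point z. *)
have [y Yy zy] : exists2 y, Y y & ~ eball y r z.
  apply: contrapT => nex; apply: (boundary_not_in oO Bz); rewrite OY => y Yy.
  by apply: contrapT => nzy; apply: nex; exists y.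
have Oball : Omega `<=` eball y r by rewrite OY => w; apply.
have mA : m < 2 * A * (k%:R - b * r).
  by rewrite -mulrA /A divfK ?gt_eqF //; lra.
have ux := quadratic_barrier (k := k) (n := n) kn b0 A0 r0 mA Oball bO HH subu Ox.
apply: (le_trans ux).
move/negP: zy; rewrite /eball /= -leNgt => rzy.
have tri := enorm_triangle y z x.
have xr : enorm (x - y) < r by exact: Oball.
have xy0 := enorm_ge0 (x - y).
have -> : 2 * A * r * enorm (z - x) = A * (enorm (z - x) * (2 * r)) by ring.
by rewrite subr_sqr ler_wpM2l ?(ltW A0) // ler_pM //; lra.
Qed.
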